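(* Let $n\ge 2$, let $a_1,\dots,a_n$ be natural numbers (positive integers), and let $b$ be a non-negative integer. Let $M$ be the least common multiple of $a_1,\dots,a_n$, let $r\in\{0,1,\dots,M-1\}$ be the remainder of $b$ modulo $M$, and let $$s=\left\lfloor n-\frac{\sum_{i=1}^{n}a_i+r}{M}\right\rfloor .$$ Put $l_0=P(r)$ and, for $k=1,2,\dots,s$, $$l_k=P(r+kM)-\binom{n}{1}P(r+(k-1)M)+\binom{n}{2}P(r+(k-2)M)-\cdots+(-1)^k\binom{n}{k}P(r).$$ Then $$P(b)=\sum_{k=0}^{s}l_k\,\overline{C}^{\,n-1}_{\lfloor b/M\rfloor+n-1-k}.$$
   Context: For an integer $l$, $P(l)$ denotes the number of $n$-tuples $(x_1,\dots,x_n)$ of non-negative integers with $\sum_{i=1}^n a_ix_i=l$ (so $P(l)=0$ for $l<0$). For integers $k$ and $m\ge 0$, $\overline{C}^{\,m}_k$ equals the binomial coefficient $\binom{k}{m}$ if $k\ge m$, and $0$ otherwise. A sum from $k=0$ to a negative number is $0$. *)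

(* Defs.v *)
From mathcomp Require Import all_boot all_order all_algebra archimedean finmap.
From mathcomp Require Import boolp classical_sets functions cardinality.

Set Implicit Arguments.
Unset Strict Implicit.
Unset Printing Implicit Defensive.

Import Order.TTheory GRing.Theory Num.Theory.

Local Open Scope ring_scope.
Local Open Scope classical_set_scope.

Definition solutions (n : nat) (a : 'I_n -> nat) (l : int) : set (n.-tuple nat) :=
  [set x | (\sum_(i < n) a i * tnth x i)%N%:Z = l].

(* [fset_set A] is empty when [A] is infinite; [finite_solutions] shows that
   this does not happen when all the [a i] are positive. *)
Definition P (n : nat) (a : 'I_n -> nat) (l : int) : nat :=
  #|` fset_set (solutions a l) |%fset.

Lemma finite_solutions (n : nat) (a : 'I_n -> nat) (l : int) :
  (forall i, (0 < a i)%N) -> finite_set (solutions a l).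
Proof.
move=> a_gt0.
pose f (y : {ffun 'I_n -> 'I_(`|l|.+1)}) : n.-tuple nat := [tuple val (y i) | i < n].
apply: (@sub_finite_set _ _ (f @` [set: {ffun 'I_n -> 'I_(`|l|.+1)}])); last first.
  exact/finite_image/finite_finset.
move=> x /= xl.
have x_le i : (tnth x i < `|l|.+1)%N.
  rewrite ltnS -xl absz_nat (bigD1 i) //=.
  by apply: leq_trans (leq_addr _ _); rewrite leq_pmull.
exists [ffun i => Ordinal (x_le i)] => //.
by apply: eq_from_tnth => i; rewrite tnth_mktuple ffunE.
Qed.

Definition Cbar (m : nat) (k : int) : int :=
  if m%:Z <= k then 'C(`|k|%N, m)%:Z else 0.

Definition sum_upto (s : int) (F : nat -> int) : int :=
  if 0 <= s then \sum_(0 <= k < `|s|%N.+1) F k else 0.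

(* At [k = 0] only the term [P a r] remains. *)
Definition lcoef (n : nat) (a : 'I_n -> nat) (M r k : nat) : int :=
  \sum_(0 <= j < k.+1)
    (-1) ^+ j * 'C(n, j)%:Z * (P a (r%:Z + (k%:Z - j%:Z) * M%:Z))%:Z.

(* Main.v *)
Require Import Defs.
From mathcomp Require Import all_boot all_order all_algebra archimedean.
From mathcomp Require Import finmap classical_sets cardinality zify.

(** The generating series of [P a] is the product of the [1 / (1 - X^(a i))].
As every [a i] divides [M], each factor can be written over the common
denominator [1 - X^M], which gives
[[
  sum_l P(l) X^l = Q(X) / (1 - X^M)^n,
  Q = prod_i (1 + X^(a i) + X^(2 a i) + ... + X^(M - a i)).
]]
Reading this identity along one residue class [r] modulo [M] yields everything.
Multiplied by [(1 - X^M)^n], it says that the alternating sum [l_k] is the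
coefficient of [X^(r + k M)] in [Q] ([lcoefE]).  Expanded with
[1 / (1 - Y)^n = sum_j binomial(j + n - 1, n - 1) Y^j], it says that
[P(r + q M)] is the sum over [k <= q] of
[l_k * binomial(q - k + n - 1, n - 1)].  The two bounds on [k] are
reconciled by noting that the summand is zero beyond either of them: [Cbar]
vanishes for [k > q], and [l_k] vanishes for [k > s] because the degree of [Q]
is [n M - sum_i a i] ([residue_poly_eq0]).

Power series are replaced by polynomials that agree with them far enough:
[1 / (1 - X)] becomes the geometric sum [geom L], and the series of [P a] is
replaced by [box_poly a M L], whose coefficients are right below degree [M L]
([coef_box_poly]).  With these truncations the factorization is the exact
identity [box_polyE].  Both readings along a residue class are instances of
[coef_mul_comp_Xn]. *)

Set Implicit Arguments.
Unset Strict Implicit.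
Unset Printing Implicit Defensive.

Import Order.TTheory GRing.Theory Num.Theory.

Local Open Scope ring_scope.

(** * Coefficients of polynomials in a power of the variable *)

Lemma sum_nat_stop (V : nmodType) (F : nat -> V) (m1 m2 : nat) :
  (forall k, (m1 <= k)%N -> F k = 0) -> (forall k, (m2 <= k)%N -> F k = 0) ->
  \sum_(0 <= k < m1) F k = \sum_(0 <= k < m2) F k.
Proof.
move=> F1 F2; wlog le12 : m1 m2 F1 F2 / (m1 <= m2)%N.
  by move=> wl; case/orP: (leq_total m1 m2) => ?; [|symmetry]; apply: wl.
rewrite (@big_cat_nat _ _ _ m1 0 m2) //= [X in _ + X]big_nat_cond.
rewrite [X in _ + X]big1 ?addr0 //.
by move=> k /andP[/andP[/F1]].
Qed.

(** All exponents of the second factor are multiples of [M], so multiplying by it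
does not mix the residue classes modulo [M] of the exponents of [p]; inside one
class what remains is a plain Cauchy product. *)
Lemma coef_mul_comp_Xn (R : comNzRingType) (p h : {poly R}) (M r q : nat) :
  (r < M)%N ->
  (p * (h \Po 'X^M))`_(r + q * M) =
  \sum_(0 <= k < q.+1) p`_(r + k * M) * h`_(q - k).
Proof.
move=> ltrM.
have coef_monom i : (p * 'X^(M * i))`_(r + q * M) =
    if (i <= q)%N then p`_(r + (q - i) * M) else 0.
  rewrite coefMXn; case: ifP; case: ifP => //; try nia.
  by move=> leiq _; congr (p`_ _); nia.
have -> : h \Po 'X^M = \sum_(0 <= i < size h) h`_i *: 'X^(M * i).
  by rewrite comp_polyE big_mkord; apply: eq_bigr => i _; rewrite exprM.
rewrite mulr_sumr coef_sum.
under eq_bigr => i _ do rewrite -scalerAr coefZ coef_monom.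
rewrite (@sum_nat_stop _ _ _ q.+1).
- rewrite big_nat_rev /= add0n; apply: eq_big_nat => k /andP[_ lekq].
  by rewrite mulrC subSS leq_subr subKn.
- by move=> k lek; rewrite nth_default ?mul0r.
- by move=> k ltqk; rewrite leqNgt ltqk mulr0.
Qed.

Lemma coef_1subX_exp (R : comNzRingType) (n j : nat) :
  ((1 - 'X) ^+ n : {poly R})`_j = (-1) ^+ j * 'C(n, j)%:R.
Proof.
rewrite exprBn coef_sum.
under eq_bigr => i _ do
  rewrite expr1n mulr1 coefMn -[(-1) ^+ _](rmorph_sign (@polyC R)) coefCM coefXn
          eq_sym.
pose F (i : nat) : R := ((-1) ^+ i * (i == j)%:R) *+ 'C(n, i).
(* The range is enlarged so that it contains [j] also when [j > n]. *)
rewrite -(big_mkord predT F) {}/F.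
rewrite (@sum_nat_stop _ _ _ (maxn n j).+1).
- rewrite big_mkord (bigD1 (inord j)) //= inordK ?ltnS ?leq_maxr // eqxx mulr1.
  rewrite big1 ?addr0; first by rewrite -mulr_natr.
  move=> i /eqP ij; case: eqP => [e|]; last by rewrite mulr0 mul0rn.
  by case: ij; apply/val_inj; rewrite /= inordK ?ltnS ?leq_maxr.
- by move=> k ltnk; rewrite bin_small.
- move=> k; rewrite gtn_max => /andP[ltnk _].
  by rewrite bin_small.
Qed.

(** * Geometric sums *)

Definition geom (c : nat) : {poly int} := \poly_(i < c) 1.

Lemma geomX1 (c : nat) : ('X - 1) * geom c = 'X^c - 1.
Proof.
rewrite /geom poly_def subrX1; congr (_ * _).
by apply: eq_bigr => i _; rewrite scale1r.
Qed.

Lemma comp_XnB1 (c d : nat) : ('X^c - 1 : {poly int}) \Po 'X^d = 'X^(d * c) - 1.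
Proof. by rewrite comp_polyB comp_Xn_poly comp_polyC exprM. Qed.

Lemma comp_polyXn_Xn (R : comNzRingType) (p : {poly R}) (c d : nat) :
  (p \Po 'X^c) \Po 'X^d = p \Po 'X^(d * c).
Proof. by rewrite -comp_polyA comp_Xn_poly -exprM. Qed.

(** Euclidean division of the exponent by [c]. The identity is checked after
multiplication by [X - 1], which turns both sides into [X^(c d) - 1]. *)
Lemma geom_mul (c d : nat) : geom (c * d) = geom c * (geom d \Po 'X^c).
Proof.
have X1_neq0 : 'X - 1 != 0 :> {poly int} by rewrite polyXsubC_eq0.
apply: (mulfI X1_neq0); rewrite mulrA !geomX1.
have -> : 'X^c - 1 = ('X^1 - 1) \Po 'X^c :> {poly int}.
  by rewrite comp_XnB1 muln1.
by rewrite -comp_polyM geomX1 comp_XnB1.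
Qed.

Lemma hockey_stick (m q : nat) :
  (\sum_(0 <= k < q.+1) 'C(k + m, m) = 'C(q + m.+1, m.+1))%N.
Proof.
elim: q => [|q IHq]; first by rewrite big_nat1 !binn.
by rewrite big_nat_recr //= IHq !(addnS, addSn) binS.
Qed.

(** [geom L] agrees with [1 / (1 - X)] below degree [L], so its [n]-th power
agrees there with the negative binomial series. *)
Lemma coef_geom_exp (L n q : nat) : (0 < n)%N -> (q < L)%N ->
  (geom L ^+ n)`_q = 'C(q + n.-1, n.-1)%:Z.
Proof.
case: n => // m _ /=; elim: m q => [|m IHm] q ltqL.
  by rewrite expr1 coef_poly ltqL bin0.
rewrite exprSr coefM -(hockey_stick m q) -natz natr_sum big_mkord.
apply: eq_bigr => -[k /=]; rewrite ltnS => lekq _.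
rewrite IHm ?coef_poly ?(leq_ltn_trans _ ltqL) ?leq_subr //.
by rewrite mulr1 natz.
Qed.

(** * The truncated generating polynomial *)

(** Generating polynomial of [\sum_i a i * x i] over the box [a i * x i < M * L]:
every tuple in it is counted once, and for [l < M * L] it contains every
solution of weight [l]. *)
Definition box_poly (n : nat) (a : 'I_n -> nat) (M L : nat) : {poly int} :=
  \prod_(i < n) (geom (M %/ a i * L) \Po 'X^(a i)).

(** The numerator [Q] of the generating series over the denominator
[(1 - X^M)^n]. *)
Definition residue_poly (n : nat) (a : 'I_n -> nat) (M : nat) : {poly int} :=
  box_poly a M 1.

(** Writing [x i = z i + (M / a i) * y i] with [z i < M / a i] turns the weight
into [\sum_i a i * z i + M * \sum_i y i], with [z] and [y] independent. *)
Lemma box_polyE (n : nat) (a : 'I_n -> nat) (M L : nat) :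
  (forall i, (a i %| M)%N) ->
  box_poly a M L = residue_poly a M * (geom L ^+ n \Po 'X^M).
Proof.
move=> a_dvd; rewrite [_ \Po _](rmorphXn (comp_poly 'X^M)) /=.
rewrite -[in X in _ ^+ X](card_ord n) -prodr_const -big_split /=.
apply: eq_bigr => i _.
by rewrite muln1 geom_mul comp_polyM comp_polyXn_Xn mulnC divnK.
Qed.

(** Expanding the product gives one monomial per tuple of the box. *)
Lemma coef_box_poly (n : nat) (a : 'I_n -> nat) (M L l : nat) :
  (forall i, (0 < a i)%N) -> (forall i, (a i %| M)%N) -> (l < M * L)%N ->
  (box_poly a M L)`_l = (P a l)%:Z.
Proof.
move=> a_gt0 a_dvd ltl.
have le_box i : (M %/ a i * L <= M * L)%N by rewrite leq_mul // leq_div.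
have box_a i : (a i * (M %/ a i * L) = M * L)%N.
  by rewrite mulnA [(a i * _)%N]mulnC divnK.
pose Q (i : 'I_n) (j : 'I_(M * L)) := (j < M %/ a i * L)%N.
(* One finite index type for all factors, so that distributivity applies. *)
have -> : box_poly a M L = \prod_(i < n) \sum_(j | Q i j) 'X^(a i * j).
  apply: eq_bigr => i _.
  rewrite /geom poly_def raddf_sum /=.
  rewrite (big_ord_widen (M * L) (fun j => (1 *: 'X^j) \Po 'X^(a i))) //.
  by apply: eq_bigr => j _; rewrite scale1r comp_Xn_poly exprM.
rewrite bigA_distr_big_dep coef_sum.
pose w (f : {ffun 'I_n -> 'I_(M * L)}) := (\sum_i a i * f i)%N.
under eq_bigr => f _ do rewrite -expr_sum coefXn -/(w f).
pose A := [set f in family Q | w f == l]%SET.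
have -> : \sum_(f in family Q) (l == w f)%:R = #|A|%:Z.
  rewrite -sum1_card -natz natr_sum (bigID (fun f => w f == l)) /=.
  rewrite [X in _ + X]big1 ?addr0; last first.
    by move=> f /andP[_ /negbTE]; rewrite eq_sym => ->.
  apply: eq_big => [f|f /andP[_]]; first by rewrite [in RHS]inE.
  by rewrite eq_sym => ->.
congr Posz; rewrite /P.
pose h (f : {ffun 'I_n -> 'I_(M * L)}) : n.-tuple nat :=
  [tuple val (f i) | i < n].
have -> : fset_set (solutions a l) = [fset h f | f in A]%fset.
  apply/fsetP => x; rewrite in_fset_set; last exact: finite_solutions.
  apply/idP/imfsetP.
    rewrite inE /= /solutions /= => -[xl].
    have ltx i : (tnth x i < M %/ a i * L)%N.
      rewrite -(ltn_pmul2l (a_gt0 i)) box_a (leq_ltn_trans _ ltl) //.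
      by rewrite -xl (bigD1 i) //= leq_addr.
    exists [ffun i => Ordinal (leq_trans (ltx i) (le_box i))].
      rewrite inE; apply/andP; split.
        by apply/familyP => i; rewrite ffunE; exact: ltx.
      by apply/eqP; rewrite -xl; apply: eq_bigr => i _; rewrite ffunE.
    by apply: eq_from_tnth => i; rewrite tnth_mktuple ffunE.
  move=> [f]; rewrite !inE => /andP[_ /eqP wf] ->.
  rewrite /solutions /= -wf; congr Posz; apply: eq_bigr => i _.
  by rewrite tnth_mktuple.
rewrite card_in_imfset /= ?cardE //.
move=> f g _ _ fg; apply/ffunP => i; apply/val_inj.
by rewrite -[LHS](tnth_mktuple (fun i => val (f i))) -/(h f) fg tnth_mktuple.
Qed.

(** The [i]-th factor has degree [M - a i], so the product has degree
[n * M - \sum_i a i]. *)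
Lemma residue_poly_eq0 (n : nat) (a : 'I_n -> nat) (M l : nat) :
  (0 < M)%N -> (forall i, (a i %| M)%N) ->
  (n * M < l + \sum_(i < n) a i)%N -> (residue_poly a M)`_l = 0.
Proof.
move=> M_gt0 a_dvd ltl; apply: nth_default.
apply: leq_trans (size_poly_prod_leq _ _) _; rewrite card_ord.
have size_factor i : (size (geom (M %/ a i * 1) \Po 'X^(a i)) + a i <= M.+1)%N.
  have a_gt0 := dvdn_gt0 M_gt0 (a_dvd i).
  have q_gt0 : (0 < M %/ a i)%N by rewrite divn_gt0 // dvdn_leq.
  apply: leq_trans (leq_add (size_comp_poly_leq _ _) (leqnn _)) _.
  rewrite size_polyXn muln1 /= addSn ltnS.
  rewrite -[X in (_ <= X)%N](divnK (a_dvd i)) -{2}(prednK q_gt0) mulSn addnC.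
  rewrite leq_add2l leq_mul2r.
  by rewrite -!subn1 leq_sub2r ?orbT // size_poly.
have : (\sum_(i < n) (size (geom (M %/ a i * 1) \Po 'X^(a i)) + a i) <=
        \sum_(i < n) M.+1)%N by apply: leq_sum => i _; exact: size_factor.
rewrite big_split /= sum_nat_const card_ord mulnS leq_subLR => le_size.
rewrite -(leq_add2r (\sum_(i < n) a i)) addSn -addnA.
by apply: leq_ltn_trans le_size _; rewrite ltn_add2l.
Qed.

(** The defining alternating sum of [lcoef] is a coefficient of the product of
the generating polynomial by [(1 - X^M)^n]. This factor cancels the denominator
up to [(1 - X^(M L))^n], which is 1 below degree [M L]; [L = k + 1] suffices to
reach the exponent [r + k M]. *)
Lemma lcoefE (n : nat) (a : 'I_n -> nat) (M r k : nat) :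
  (forall i, (0 < a i)%N) -> (forall i, (a i %| M)%N) -> (r < M)%N ->
  lcoef a M r k = (residue_poly a M)`_(r + k * M).
Proof.
move=> a_gt0 a_dvd ltrM.
have -> : lcoef a M r k =
    (box_poly a M k.+1 * ((1 - 'X) ^+ n \Po 'X^M))`_(r + k * M).
  rewrite coef_mul_comp_Xn // /lcoef big_nat_rev /= add0n.
  apply: eq_big_nat => j /andP[_]; rewrite ltnS => lejk.
  rewrite subSS coef_1subX_exp natz coef_box_poly //; last by nia.
  rewrite mulrC; congr (_%:Z * _); congr (P a _); nia.
have geom1X : geom k.+1 * (1 - 'X) = (1 - 'X) \Po 'X^(k.+1) :> {poly int}.
  rewrite comp_polyB comp_polyC comp_polyX -[LHS]opprK -mulrN opprB mulrC.
  by rewrite geomX1 opprB.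
rewrite box_polyE // -mulrA -comp_polyM -exprMn geom1X.
(* All terms but the last involve a coefficient of [(1 - X^(k+1))^n] of positive
   index at most [k], which is zero. *)
rewrite coef_mul_comp_Xn // big_nat_recr //= subnn big_nat_cond big1 => [|j].
  rewrite -(rmorphXn (comp_poly 'X^(k.+1))) /= coef_comp_poly_Xn // dvdn0 div0n.
  by rewrite coef_1subX_exp expr0 bin0 !mulr1 add0r.
rewrite andbT => /= ltjk.
rewrite -(rmorphXn (comp_poly 'X^(k.+1))) /= coef_comp_poly_Xn //.
by rewrite gtnNdvd ?mulr0 //; lia.
Qed.

(** * The formula *)

Lemma sum_uptoE (s : int) (N : nat) (F : nat -> int) :
  (forall k : nat, s < k%:Z -> F k = 0) ->
  (forall k, (N <= k)%N -> F k = 0) ->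
  sum_upto s F = \sum_(0 <= k < N) F k.
Proof.
move=> Fs FN; rewrite /sum_upto; case: ifPn => [s_ge0|s_lt0].
  by apply: sum_nat_stop => // k ltsk; apply: Fs; lia.
by rewrite big1 // => k _; apply: Fs; lia.
Qed.

Lemma floor_divn (b M : nat) : (0 < M)%N ->
  Num.floor (b%:R / M%:R : rat) = (b %/ M)%N%:Z.
Proof.
move=> M_gt0; have M_gt0' : 0 < M%:R :> rat by rewrite ltr0n.
apply: floor_def; rewrite ler_pdivlMr // ltr_pdivrMr //.
rewrite -PoszD -!pmulrn -!natrM ler_nat ltr_nat.
by rewrite leq_trunc_div addn1 ltn_ceil.
Qed.

Theorem theorem3p1 (n : nat) (a : 'I_n -> nat) (b : nat)
    (n_ge2 : (2 <= n)%N) (a_gt0 : forall i, (0 < a i)%N) :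
  let M := (\big[lcmn/1]_(i < n) a i)%N in
  let r := (b %% M)%N in
  let s : int :=
    Num.floor (n%:R - (\sum_(i < n) a i + r)%N%:R / M%:R : rat) in
  (P a b%:Z)%:Z =
    sum_upto s (fun k : nat =>
      lcoef a M r k *
      Cbar n.-1 (Num.floor (b%:R / M%:R : rat) + n%:Z - 1 - k%:Z)).
Proof.
move=> M r s.
have a_dvd i : (a i %| M)%N by exact: (biglcmn_sup i).
have M_gt0 : (0 < M)%N.
  by rewrite /M; elim/big_ind: _ => // x y; rewrite lcmn_gt0 => -> ->.
have ltrM : (r < M)%N by rewrite ltn_mod.
pose q := (b %/ M)%N.
have def_b : b = (r + q * M)%N by rewrite addnC -divn_eq.
rewrite (@sum_uptoE _ q.+1); first last.
- move=> k ltqk; rewrite floor_divn // /Cbar.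
  by case: ifP => [|_]; [rewrite -/q; lia|rewrite mulr0].
(* [k > s] means exactly that [r + k M] exceeds the degree of [residue_poly]. *)
- move=> k ltsk; rewrite lcoefE // residue_poly_eq0 ?mul0r //.
  rewrite ltNge floor_ge_int lerBrDr -lerBrDl ler_pdivrMr ?ltr0n // in ltsk.
  rewrite mulrBl -lerBlDr opprK -pmulrn -!natrM -natrD ler_nat -ltnNge in ltsk.
  lia.
(* [L = q + 1] is the least size for which [b < M * L]. *)
rewrite -(@coef_box_poly n a M q.+1) //; last by nia.
rewrite box_polyE // {1}def_b coef_mul_comp_Xn //.
apply: eq_big_nat => k /andP[_]; rewrite ltnS => lekq.
rewrite lcoefE // floor_divn // -/q coef_geom_exp; [|lia..].
by congr (_ * _); rewrite /Cbar ifT; [congr (Posz 'C(_, _)); lia|lia].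
Qed.
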